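(* Let $\beta_a: I\to M\subset G^3$ be a unit-speed curve on a surface $M$ in the Galilean space $G^3$ which is an asymptotic curve ($\kappa_n\equiv0$), with geodesic curvature $\kappa_g$ and geodesic torsion $\tau_g$. Then its position vector is given by $$\beta_a(x)=\Bigg(x,\ \int\!\!\int\kappa_g(x)\sin\Big(\int\tau_g(x)\,dx\Big)dx\,dx,\ \int\!\!\int\kappa_g(x)\cos\Big(\int\tau_g(x)\,dx\Big)dx\,dx\Bigg).$$
   Context: The Galilean space $G^3$ is $\mathbb R^3$ with the scalar product $\mathbf v\cdot_G\mathbf w=v_1w_1$ if $v_1\ne0$ or $w_1\neq 0$, and $\mathbf v\cdot_G\mathbf w=v_2w_2+v_3w_3$ if $v_1=w_1=0$; the norm is $\|\mathbf v\|_G=\sqrt{|\mathbf v\cdot_G\mathbf v|}$ and the cross product is $\mathbf v\times_G\mathbf w=(0,\,v_3w_1-v_1w_3,\,v_1w_2-v_2w_1)$. A unit-speed curve (parametrized by arc length) is one of the form $\beta(x)=(x,y(x),z(x))$, $x\in I\subset\mathbb R$. $M$ is oriented; the Darboux frame of a unit-speed curve $\beta$ with respect to $M$ is $\{\mathbf T,\mathbf Q,\mathbf n\}$ with $\mathbf T=\beta'$, $\mathbf n$ the unit normal of $M$ along $\beta$ (a vector field with first component $0$), and $\mathbf Q=\mathbf n\times_G\mathbf T$. The geodesic curvature $\kappa_g$, normal curvature $\kappa_n$ and geodesic torsion $\tau_g$ are the functions in $\mathbf T'=\kappa_g\mathbf Q+\kappa_n\mathbf n$, $\mathbf Q'=\tau_g\mathbf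 n$, $\mathbf n'=-\tau_g\mathbf Q$. The symbol $\int g(x)\,dx$ denotes an antiderivative of $g$, the constants of integration being suitably chosen. *)

(* Defs.v *)
From Stdlib Require Import Reals.
From Coquelicot Require Import Coquelicot.
Open Scope R_scope.

Notation G3 := (R * R * R)%type.

Definition x1 (v : G3) : R := fst (fst v).
Definition x2 (v : G3) : R := snd (fst v).
Definition x3 (v : G3) : R := snd v.

Definition dotG (v w : G3) : R :=
  if Req_dec_T (x1 v) 0 then
    if Req_dec_T (x1 w) 0 then x2 v * x2 w + x3 v * x3 w
    else x1 v * x1 w
  else x1 v * x1 w.

Definition normG (v : G3) : R := sqrt (Rabs (dotG v v)).

Definition crossG (v w : G3) : G3 :=
  (0, x3 v * x1 w - x1 v * x3 w, x1 v * x2 w - x2 v * x1 w).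

Definition interval (I : R -> Prop) : Prop :=
  (exists a b, I a /\ I b /\ a < b) /\
  (forall a b x, I a -> I b -> a <= x <= b -> I x).

(* The derivative relative to I: the usual one at interior points, one-sided
   at an endpoint of I that belongs to I. *)
Definition is_derive_on {V : NormedModule R_AbsRing}
    (I : R -> Prop) (f : R -> V) (x : R) (l : V) : Prop :=
  filterdiff f (within I (locally x)) (fun h => scal h l).

Definition antiderivative_on (I : R -> Prop) (g G : R -> R) : Prop :=
  forall x, I x -> is_derive_on I G x (g x).

(* phi, with continuous inverse psi, parametrizes the part of M lying in V.
   Class C^1 is all that is asked for, so smooth surfaces are included. *)
Definition local_parametrization (M V : G3 -> Prop) (U : R * R -> Prop)
    (phi : R * R -> G3) (psi : G3 -> R * R) : Prop :=
  (exists phi_u phi_v : R * R -> G3, forall q, U q ->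
     filterdiff phi (locally q)
       (fun h : R * R =>
          plus (scal (fst h) (phi_u q)) (scal (snd h) (phi_v q))) /\
     continuous phi_u q /\ continuous phi_v q /\
     (forall a b : R,
        plus (scal a (phi_u q)) (scal b (phi_v q)) = zero ->
        a = 0 /\ b = 0)) /\
  (forall q, U q -> M (phi q) /\ V (phi q) /\ psi (phi q) = q) /\
  (forall p, M p -> V p ->
     U (psi p) /\ phi (psi p) = p /\
     filterlim psi (within M (locally p)) (locally (psi p))).

Definition regular_surface (M : G3 -> Prop) : Prop :=
  forall p, M p ->
  exists (V : G3 -> Prop) (U : R * R -> Prop)
         (phi : R * R -> G3) (psi : G3 -> R * R),
    open V /\ V p /\ open U /\ local_parametrization M V U phi psi.

Definition tangent (M : G3 -> Prop) (p v : G3) : Prop :=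
  exists c : R -> G3,
    c 0 = p /\ locally 0 (fun t => M (c t)) /\ is_derive c 0 v.

(* The first component of n being 0, n is Galilean-orthogonal to every tangent
   vector with nonzero first component; the last condition bears on the tangent
   vectors (0, a, b).  It has no solution at a point where the tangent plane is
   the Euclidean plane x1 = const, so a surface with a unit normal field has
   no such point. *)
Definition unit_normal_at (M : G3 -> Prop) (p n : G3) : Prop :=
  x1 n = 0 /\ normG n = 1 /\ (forall v, tangent M p v -> dotG n v = 0).

(* The orientation of M is the choice of the continuous unit normal field N. *)
Definition oriented_surface (M : G3 -> Prop) (N : G3 -> G3) : Prop :=
  regular_surface M /\
  (forall p, M p ->
     unit_normal_at M p (N p) /\
     filterlim N (within M (locally p)) (locally (N p))).

Definition unit_speed_curve_on (I : R -> Prop) (M : G3 -> Prop)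
    (beta : R -> G3) : Prop :=
  forall x, I x -> M (beta x) /\ x1 (beta x) = x.

Record Darboux_frame (I : R -> Prop) (N : G3 -> G3) (beta : R -> G3)
    (T Q n : R -> G3) (kappa_g kappa_n tau_g : R -> R) : Prop := {
  frame_T : forall x, I x -> is_derive_on I beta x (T x);
  frame_n : forall x, I x -> n x = N (beta x);
  frame_Q : forall x, I x -> Q x = crossG (n x) (T x);
  derive_T : forall x, I x ->
    is_derive_on I T x
      (plus (scal (kappa_g x) (Q x)) (scal (kappa_n x) (n x)));
  derive_Q : forall x, I x -> is_derive_on I Q x (scal (tau_g x) (n x));
  derive_n : forall x, I x -> is_derive_on I n x (scal (- tau_g x) (Q x))
}.

Definition asymptotic (I : R -> Prop) (kappa_n : R -> R) : Prop :=
  forall x, I x -> kappa_n x = 0.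

(* Main.v *)
(* The normal n is a unit vector in the Euclidean plane x1 = 0, so over I it can
   be written (0, cos theta, sin theta) with theta continuous; then
   Q = n x T = (0, sin theta, - cos theta), and n' = - tau_g Q gives
   theta' = tau_g.  As kappa_n = 0, T' = kappa_g Q, and it remains to read off
   the components.
   Since tau_g need not be Riemann integrable, theta cannot be obtained by
   integrating it; it is a topological lift of n to the universal cover of the
   circle, shown to be differentiable afterwards. *)

Require Import Defs.
From Stdlib Require Import Reals Lra ClassicalEpsilon.
From Coquelicot Require Import Coquelicot.
Open Scope R_scope.

(** * Angles of points of the unit circle *)

(** On the circle, [s / (1 + c)] is the tangent of the half angle. The resulting angle depends
    continuously on [(c, s)] away from the point (-1, 0). *)
Lemma cos_sin_double_atan (c s : R) :
  -1 < c -> c * c + s * s = 1 ->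
  cos (2 * atan (s / (1 + c))) = c /\ sin (2 * atan (s / (1 + c))) = s.
Proof.
intros hc h.
set (t := s / (1 + c)).
assert (ht : 1 + t * t = 2 / (1 + c)).
{ unfold t.
  replace (s / (1 + c) * (s / (1 + c))) with (s * s / ((1 + c) * (1 + c)))
    by (field; lra).
  replace (s * s) with ((1 - c) * (1 + c)) by lra. field. lra. }
assert (hpos : 0 < 1 + t * t) by nra.
assert (hs : sqrt (1 + t * t) * sqrt (1 + t * t) = 1 + t * t)
  by (apply sqrt_sqrt; lra).
assert (hs0 : 0 < sqrt (1 + t * t)) by (apply sqrt_lt_R0; exact hpos).
rewrite cos_2a_cos, sin_2a, cos_atan, sin_atan; unfold Rsqr; split.
- replace (2 * (1 / sqrt (1 + t * t)) * (1 / sqrt (1 + t * t)) - 1)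
    with (2 / (sqrt (1 + t * t) * sqrt (1 + t * t)) - 1) by (field; lra).
  rewrite hs, ht. field. lra.
- replace (2 * (t / sqrt (1 + t * t)) * (1 / sqrt (1 + t * t)))
    with (2 * t / (sqrt (1 + t * t) * sqrt (1 + t * t))) by (field; lra).
  rewrite hs, ht. unfold t. field. lra.
Qed.

Lemma unit_circle_angle (c s : R) :
  c * c + s * s = 1 -> exists t, cos t = c /\ sin t = s.
Proof.
intros h.
destruct (Rlt_dec (-1) c) as [hc | hc].
- eexists. exact (cos_sin_double_atan c s hc h).
- exists PI. rewrite cos_PI, sin_PI. split; nra.
Qed.

(** * Retraction of the line onto a segment *)

(** For [a <= b], precomposing with this retraction turns a function known only on the segment into
    one continuous on all of R, so that no endpoint needs separate treatment. *)
Definition clamp (a b x : R) : R := Rmax a (Rmin b x).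

Ltac unclamp := unfold clamp, Rmax, Rmin, Rabs in *;
  repeat destruct (Rle_dec _ _); repeat destruct (Rcase_abs _); try lra.

Lemma clamp_in (a b x : R) : a <= b -> a <= clamp a b x <= b.
Proof. intros h. unclamp. Qed.

Lemma clamp_id (a b x : R) : a <= x <= b -> clamp a b x = x.
Proof. intros h. unclamp. Qed.

Lemma clamp_lipschitz (a b x y : R) :
  Rabs (clamp a b x - clamp a b y) <= Rabs (x - y).
Proof. unclamp. Qed.

Lemma clamp_step (a b h x : R) :
  a <= b -> 0 <= h -> Rabs (clamp a b x - clamp a (b + h) x) <= h.
Proof. intros hab hh. unclamp. Qed.

Lemma continuous_clamp_on (J : R -> Prop) (f : R -> R) (a b : R) :
  a <= b -> (forall x, a <= x <= b -> J x) -> continuous_on J f ->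
  forall x, continuous (fun y => f (clamp a b y)) x.
Proof.
intros hab hJ hf x P hP.
destruct (hf _ (hJ _ (clamp_in a b x hab)) P hP) as [d hd].
exists d. intros y hy. apply hd.
- eapply Rle_lt_trans; [exact (clamp_lipschitz a b y x) | exact hy].
- apply hJ, clamp_in, hab.
Qed.

Lemma continuous_clamp (f : R -> R) (a b : R) :
  a <= b -> (forall x, continuous f x) ->
  forall x, continuous (fun y => f (clamp a b y)) x.
Proof.
intros hab hf. apply (continuous_clamp_on (fun _ => True)); auto.
intros x _. apply filterlim_filter_le_1 with (2 := hf x).
apply filter_le_within.
Qed.

(** * Existence and uniqueness of a continuous angle on a segment *)

(** The lift is extended by one step of length [h] at a time. Points of the circle with inner
    product above -1 are not antipodal, so the angle between them is given continuously by the
    half-angle formula. Beyond the segment reached so far the clamp freezes the curve. *)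
Lemma angle_lift_steps (F G : R -> R) (a h : R) :
  0 <= h ->
  (forall x, continuous F x) -> (forall x, continuous G x) ->
  (forall x, F x * F x + G x * G x = 1) ->
  (forall x y, Rabs (x - y) <= h -> -1 < F x * F y + G x * G y) ->
  forall k : nat, exists theta : R -> R,
    (forall x, continuous theta x) /\
    (forall x, cos (theta x) = F (clamp a (a + INR k * h) x) /\
               sin (theta x) = G (clamp a (a + INR k * h) x)).
Proof.
intros hh cF cG hFG hclose k.
induction k as [| k [theta [ctheta htheta]]].
- destruct (unit_circle_angle (F a) (G a) (hFG a)) as [t ht].
  exists (fun _ => t). split; [intros x; apply continuous_const |].
  intros x. replace (clamp a (a + INR 0 * h) x) with a; [exact ht |].
  simpl. unclamp.
- set (p := clamp a (a + INR k * h)) in *.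
  set (q := clamp a (a + INR (S k) * h)).
  assert (hk : 0 <= INR k * h) by (apply Rmult_le_pos; [apply pos_INR | lra]).
  assert (hpq : forall x, Rabs (p x - q x) <= h).
  { intros x. unfold p, q. rewrite S_INR.
    replace (a + (INR k + 1) * h) with (a + INR k * h + h) by ring.
    apply clamp_step; lra. }
  set (c := fun x => F (p x) * F (q x) + G (p x) * G (q x)).
  set (s := fun x => F (p x) * G (q x) - G (p x) * F (q x)).
  assert (hc : forall x, -1 < c x) by (intros x; apply hclose, hpq).
  (* the added term is the angle from (F, G) (p x) to (F, G) (q x) *)
  exists (fun x => theta x + 2 * atan (s x / (1 + c x))). split.
  + assert (cp : forall H : R -> R, (forall x, continuous H x) ->
        forall x, continuous (fun y => H (p y)) x)
      by (intros H cH; apply continuous_clamp; [lra | exact cH]).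
    assert (cq : forall H : R -> R, (forall x, continuous H x) ->
        forall x, continuous (fun y => H (q y)) x)
      by (intros H cH; apply continuous_clamp; [rewrite S_INR; lra | exact cH]).
    intros x.
    apply (continuous_plus theta); [apply ctheta |].
    apply (continuous_scal_r 2 (fun x => atan (s x / (1 + c x)))).
    apply continuous_atan_comp.
    apply (continuous_mult s (fun x => / (1 + c x))).
    * apply (continuous_minus (fun x => F (p x) * G (q x))
               (fun x => G (p x) * F (q x)));
        apply (continuous_mult (K := R_AbsRing)); auto.
    * apply continuous_Rinv_comp; [| specialize (hc x); lra].
      apply (continuous_plus (fun _ => 1) c); [apply continuous_const |].
      apply (continuous_plus (fun x => F (p x) * F (q x))
               (fun x => G (p x) * G (q x)));
        apply (continuous_mult (K := R_AbsRing)); auto.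
  + intros x.
    (* [c x] and [s x] are the inner product and the determinant of two unit vectors, so this is
       Lagrange's identity. *)
    assert (hcs : c x * c x + s x * s x = 1).
    { unfold c, s.
      transitivity ((F (p x) * F (p x) + G (p x) * G (p x)) *
                    (F (q x) * F (q x) + G (q x) * G (q x))); [ring |].
      rewrite !hFG. ring. }
    destruct (cos_sin_double_atan _ _ (hc x) hcs) as [e1 e2].
    destruct (htheta x) as [e3 e4].
    rewrite cos_plus, sin_plus, e1, e2, e3, e4. unfold c, s.
    pose proof (hFG (p x)) as hp. split.
    * transitivity ((F (p x) * F (p x) + G (p x) * G (p x)) * F (q x));
        [ring | rewrite hp; ring].
    * transitivity ((F (p x) * F (p x) + G (p x) * G (p x)) * G (q x));
        [ring | rewrite hp; ring].
Qed.

Lemma clamp_uniformly_continuous (F : R -> R) (a b eps : R) :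
  0 < eps -> a <= b -> (forall x, continuous F x) ->
  exists d, 0 < d /\ forall x y, Rabs (x - y) < d ->
    Rabs (F (clamp a b x) - F (clamp a b y)) < eps.
Proof.
intros heps hab cF.
assert (cF' : forall x, a <= x <= b -> continuity_pt F x)
  by (intros x _; apply continuity_pt_filterlim, cF).
destruct (Heine_cor2 cF' (mkposreal _ heps)) as [d hd].
exists d. split; [apply cond_pos |]. intros x y hxy.
apply hd; try (apply clamp_in, hab).
eapply Rle_lt_trans; [apply clamp_lipschitz | exact hxy].
Qed.

Lemma angle_lift_segment (f g : R -> R) (J : R -> Prop) (a b : R) :
  a <= b -> (forall x, a <= x <= b -> J x) ->
  continuous_on J f -> continuous_on J g ->
  (forall x, J x -> f x * f x + g x * g x = 1) ->
  exists theta : R -> R,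
    (forall x, continuous theta x) /\
    (forall x, a <= x <= b -> cos (theta x) = f x /\ sin (theta x) = g x).
Proof.
intros hab hJ cf cg hfg.
set (F := fun x => f (clamp a b x)). set (G := fun x => g (clamp a b x)).
assert (cF : forall x, continuous F x)
  by exact (continuous_clamp_on J f a b hab hJ cf).
assert (cG : forall x, continuous G x)
  by exact (continuous_clamp_on J g a b hab hJ cg).
assert (hFG : forall x, F x * F x + G x * G x = 1)
  by (intros x; apply hfg, hJ, clamp_in, hab).
(* Idempotence of the clamp rewrites [F x] as [F (clamp a b x)], the form to which the uniform
   continuity lemma applies. *)
assert (hcc : forall x, clamp a b (clamp a b x) = clamp a b x)
  by (intros x; apply clamp_id, clamp_in, hab).
destruct (clamp_uniformly_continuous F a b 1 Rlt_0_1 hab cF) as [d1 [hd1 u1]].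
destruct (clamp_uniformly_continuous G a b 1 Rlt_0_1 hab cG) as [d2 [hd2 u2]].
set (h := Rmin d1 d2 / 2).
assert (hh : 0 < h /\ h < d1 /\ h < d2)
  by (unfold h, Rmin; destruct (Rle_dec d1 d2); lra).
(* For unit vectors the inner product is 1 minus half the squared distance. Coordinates differing by
   less than 1 therefore make it positive. *)
assert (hclose : forall x y, Rabs (x - y) <= h -> -1 < F x * F y + G x * G y).
{ intros x y hxy.
  assert (v1 : Rabs (F x - F y) < 1).
  { unfold F at 1 2. rewrite <- (hcc x), <- (hcc y). apply u1. lra. }
  assert (v2 : Rabs (G x - G y) < 1).
  { unfold G at 1 2. rewrite <- (hcc x), <- (hcc y). apply u2. lra. }
  apply Rabs_def2 in v1. apply Rabs_def2 in v2.
  pose proof (hFG x). pose proof (hFG y).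
  assert ((F x - F y) * (F x - F y) < 1) by nra.
  assert ((G x - G y) * (G x - G y) < 1) by nra.
  nra. }
(* [k] steps of length [h] starting from [a] reach at least [b]. *)
destruct (INR_unbounded ((b - a) / h)) as [k hk].
assert (hk' : b <= a + INR k * h).
{ apply (Rmult_lt_compat_r h) in hk; [| lra].
  replace ((b - a) / h * h) with (b - a) in hk by (field; lra). lra. }
destruct (angle_lift_steps F G a h (Rlt_le _ _ (proj1 hh)) cF cG hFG hclose k)
  as [theta [ctheta htheta]].
exists theta. split; [exact ctheta |]. intros x hx.
specialize (htheta x). rewrite clamp_id in htheta by lra.
unfold F, G in htheta. rewrite clamp_id in htheta by lra. exact htheta.
Qed.

(** [D] takes its values in the discrete set of multiples of 2 PI, so by connectedness it cannot
    leave 0. *)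
Lemma continuous_null_of_cos_eq_1 (D : R -> R) (x0 : R) :
  (forall x, continuous D x) -> (forall x, cos (D x) = 1) -> D x0 = 0 ->
  forall x, D x = 0.
Proof.
intros cD hcos h0 x.
destruct (Req_dec (D x) 0) as [e | ne]; [exact e | exfalso].
(* Dividing by [w] gives a value between 0 and [D x] that is nonzero and less than 1 in absolute
   value. [D] attains it by the intermediate value theorem, yet its cosine is less than 1. *)
set (w := 1 + Rabs (D x)).
assert (hw : 0 < Rabs (D x)) by (apply Rabs_pos_lt, ne).
assert (hv : Rabs (D x / w) < 1).
{ unfold Rdiv. rewrite Rabs_mult, (Rabs_pos_eq (/ w))
    by (left; apply Rinv_0_lt_compat; unfold w; lra).
  apply (Rmult_lt_reg_r w); unfold w in *; [lra |].
  rewrite Rmult_assoc, Rinv_l; lra. }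
assert (hprod : D x / w * w = D x) by (field; unfold w; lra).
assert (hv0 : D x / w <> 0)
  by (intros e; apply ne; rewrite <- hprod, e; ring).
destruct (IVT_gen D x0 x (D x / w)) as [y [_ hy]].
- intros z. apply continuity_pt_filterlim, cD.
- rewrite h0. set (v := D x / w) in *. clearbody v.
  unfold w in *. clear w. unfold Rmin, Rmax, Rabs in *.
  destruct (Rle_dec 0 (D x)); destruct (Rcase_abs (D x)); nra.
- pose proof (hcos y) as e. rewrite hy in e.
  pose proof PI2_1.
  assert (hlt : cos (Rabs (D x / w)) < cos 0).
  { apply cos_decreasing_1; try lra; try apply Rabs_pos.
    apply Rabs_pos_lt, hv0. }
  rewrite cos_0 in hlt. revert hlt. unfold Rabs.
  destruct (Rcase_abs (D x / w)); rewrite ?cos_neg; lra.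
Qed.

(** The difference of the two lifts, extended by the clamp, is continuous, has cosine 1 everywhere
    and vanishes at [x0]. *)
Lemma angle_lift_unique (f g th1 th2 : R -> R) (a b x0 : R) :
  (forall x, continuous th1 x) -> (forall x, continuous th2 x) ->
  (forall x, a <= x <= b -> cos (th1 x) = f x /\ sin (th1 x) = g x) ->
  (forall x, a <= x <= b -> cos (th2 x) = f x /\ sin (th2 x) = g x) ->
  a <= x0 <= b -> th1 x0 = th2 x0 ->
  forall x, a <= x <= b -> th1 x = th2 x.
Proof.
intros c1 c2 h1 h2 hx0 e0 x hx.
set (D := fun y => th1 (clamp a b y) - th2 (clamp a b y)).
assert (hD : D x = 0).
{ apply (continuous_null_of_cos_eq_1 D x0).
  - intros y.
    apply (continuous_minus (fun y => th1 (clamp a b y))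
             (fun y => th2 (clamp a b y)));
      apply continuous_clamp; auto; lra.
  - intros y. unfold D.
    assert (hy : a <= clamp a b y <= b) by (apply clamp_in; lra).
    destruct (h1 _ hy) as [e1 e1']. destruct (h2 _ hy) as [e2 e2'].
    rewrite cos_minus, e1, e1', <- e2, <- e2'.
    pose proof (sin2_cos2 (th2 (clamp a b y))) as e. unfold Rsqr in e. lra.
  - unfold D. rewrite (clamp_id a b x0 hx0). lra. }
unfold D in hD. rewrite clamp_id in hD by exact hx. lra.
Qed.

(** * Continuous angle on an arbitrary interval *)

(** Provides a segment through the base point [x0] that is also a neighbourhood of [x] relative to
    [I], so a lift on it decides continuity at [x]. On a side where [I] has no point beyond [x], [x]
    itself is the endpoint. *)
Lemma interval_neighbourhood (I : R -> Prop) (x0 x : R) :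
  I x0 -> I x ->
  exists a b, I a /\ I b /\ a <= x0 <= b /\ a <= x <= b /\
    within I (locally x) (fun y => a <= y <= b).
Proof.
intros h0 hx.
assert (hl : exists a, I a /\ a <= x0 /\ a <= x /\
          exists d, 0 < d /\ forall y, I y -> x - d < y -> a <= y).
{ destruct (excluded_middle_informative (exists z, I z /\ z < x))
    as [[z [hz hzx]] | hno].
  - exists (Rmin z x0). split; [unfold Rmin; destruct (Rle_dec z x0); auto |].
    pose proof (Rmin_l z x0). pose proof (Rmin_r z x0).
    repeat split; try lra.
    exists (x - z). split; [lra | intros y _ hy; lra].
  - assert (hmin : forall y, I y -> x <= y).
    { intros y hy. apply Rnot_lt_le. intros hlt. apply hno. now exists y. }
    exists x. repeat split; auto; try lra.
    exists 1. split; [lra | auto]. }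
assert (hr : exists b, I b /\ x0 <= b /\ x <= b /\
          exists d, 0 < d /\ forall y, I y -> y < x + d -> y <= b).
{ destruct (excluded_middle_informative (exists z, I z /\ x < z))
    as [[z [hz hzx]] | hno].
  - exists (Rmax z x0). split; [unfold Rmax; destruct (Rle_dec z x0); auto |].
    pose proof (Rmax_l z x0). pose proof (Rmax_r z x0).
    repeat split; try lra.
    exists (z - x). split; [lra | intros y _ hy; lra].
  - assert (hmax : forall y, I y -> y <= x).
    { intros y hy. apply Rnot_lt_le. intros hlt. apply hno. now exists y. }
    exists x. repeat split; auto; try lra.
    exists 1. split; [lra | auto]. }
destruct hl as [a [ha [ha0 [hax [d1 [hd1 H1]]]]]].
destruct hr as [b [hb [hb0 [hbx [d2 [hd2 H2]]]]]].
exists a, b. repeat split; auto.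
assert (hd : 0 < Rmin d1 d2) by (apply Rmin_pos; assumption).
exists (mkposreal _ hd). intros y hy hIy.
assert (hy' : Rabs (y - x) < Rmin d1 d2) by exact hy.
apply Rabs_def2 in hy'.
pose proof (Rmin_l d1 d2). pose proof (Rmin_r d1 d2).
split; [apply H1 | apply H2]; auto; lra.
Qed.

(* The lifts on the segments of I that contain x0, normalized at x0, agree
   where they overlap, so they patch together. *)
Lemma angle_lift_interval (I : R -> Prop) (f g : R -> R) :
  interval I -> continuous_on I f -> continuous_on I g ->
  (forall x, I x -> f x * f x + g x * g x = 1) ->
  exists theta : R -> R,
    continuous_on I theta /\
    (forall x, I x -> cos (theta x) = f x /\ sin (theta x) = g x).
Proof.
intros [[x0 [_ [h0 _]]] hI] cf cg hfg.
destruct (unit_circle_angle _ _ (hfg x0 h0)) as [t0 ht0].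
set (lift := fun a b (th : R -> R) =>
  (forall x, continuous th x) /\ th x0 = t0 /\
  (forall x, a <= x <= b -> cos (th x) = f x /\ sin (th x) = g x)).
assert (hex : forall a b, I a -> I b -> a <= x0 <= b ->
          exists th, lift a b th).
{ intros a b ha hb hab.
  destruct (angle_lift_segment f g I a b) as [th [cth hth]]; auto; try lra.
  { intros x hx. exact (hI a b x ha hb hx). }
  (* [th x0] and [t0] are angles of the same point, so translating by their difference normalizes
     the lift without changing its cosine and sine. *)
  exists (fun x => (th x + - th x0) + t0). split; [| split].
  - intros x.
    repeat apply (continuous_plus (K := R_AbsRing) (V := R_NormedModule));
      [apply cth | apply continuous_const | apply continuous_const].
  - ring.
  - intros x hx.
    destruct (hth x hx) as [e1 e2]. destruct (hth x0 hab) as [e3 e4].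
    destruct ht0 as [e5 e6].
    rewrite (cos_plus (th x + - th x0)), (sin_plus (th x + - th x0)),
      cos_plus, sin_plus, cos_neg, sin_neg, e1, e2, e3, e4, e5, e6.
    pose proof (hfg x0 h0) as hu. split.
    + transitivity (f x * (f x0 * f x0 + g x0 * g x0));
        [ring | rewrite hu; ring].
    + transitivity (g x * (f x0 * f x0 + g x0 * g x0));
        [ring | rewrite hu; ring]. }
(* For each [x] a normalized lift on the segment between [x0] and [x] is chosen, and only its value
   at [x] is kept. By uniqueness, [hloc] makes this value independent of the choice. *)
set (theta := fun x =>
  epsilon (inhabits (fun _ : R => 0)) (lift (Rmin x x0) (Rmax x x0)) x).
assert (hloc : forall a b th, I a -> I b -> a <= x0 <= b -> lift a b th ->
          forall x, a <= x <= b -> theta x = th x).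
{ intros a b th ha hb hab [cth [e0 hth]] x hx.
  assert (hIx : I x) by exact (hI a b x ha hb hx).
  assert (hmM : I (Rmin x x0) /\ I (Rmax x x0) /\
            a <= Rmin x x0 /\ Rmax x x0 <= b /\
            Rmin x x0 <= x0 <= Rmax x x0 /\ Rmin x x0 <= x <= Rmax x x0)
    by (unfold Rmin, Rmax; destruct (Rle_dec x x0); repeat split; auto; lra).
  destruct hmM as [hm [hM [ham [hMb [hx0 hx']]]]].
  unfold theta.
  destruct (epsilon_spec (inhabits (fun _ : R => 0)) _ (hex _ _ hm hM hx0))
    as [cE [eE hE]].
  apply (angle_lift_unique f g _ _ (Rmin x x0) (Rmax x x0) x0); auto; try lra.
  intros y hy. apply hth. lra. }
exists theta. split.
- intros x hx.
  destruct (interval_neighbourhood I x0 x h0 hx)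
    as [a [b [ha [hb [h0' [hx' hn]]]]]].
  destruct (hex a b ha hb h0') as [th hth].
  assert (hl := hloc a b th ha hb h0' hth).
  rewrite (hl x hx').
  apply (filterlim_ext_loc th).
  + eapply filter_imp; [| exact hn]. intros y hy. symmetry. exact (hl y hy).
  + destruct hth as [cth _].
    apply filterlim_filter_le_1 with (2 := cth x). apply filter_le_within.
- intros x hx.
  destruct (interval_neighbourhood I x0 x h0 hx)
    as [a [b [ha [hb [h0' [hx' hn]]]]]].
  destruct (hex a b ha hb h0') as [th hth].
  rewrite (hloc a b th ha hb h0' hth x hx').
  destruct hth as [_ [_ hth]]. exact (hth x hx').
Qed.

(** * Calculus of derivatives relative to an interval *)

Lemma is_derive_on_linear (V : NormedModule R_AbsRing) (I : R -> Prop)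
    (f : R -> V) (L : V -> R) (x : R) (v : V) :
  is_linear L -> is_derive_on I f x v ->
  is_derive_on I (fun y => L (f y)) x (L v).
Proof.
intros hL hf.
apply (filterdiff_ext_lin _ (fun h : R => L (scal h v))).
- apply (filterdiff_comp (W := R_NormedModule) f L); [exact hf |].
  apply filterdiff_linear, hL.
- intros h. apply (linear_scal L hL).
Qed.

Lemma is_linear_x1 : is_linear (V := R_NormedModule) x1.
Proof. apply (is_linear_comp fst fst); apply is_linear_fst. Qed.

Lemma is_linear_x2 : is_linear (V := R_NormedModule) x2.
Proof.
apply (is_linear_comp fst snd); [apply is_linear_fst | apply is_linear_snd].
Qed.

Lemma is_linear_x3 : is_linear (V := R_NormedModule) x3.
Proof. apply is_linear_snd. Qed.

Lemma is_derive_on_bound (I : R -> Prop) (f : R -> R) (x l : R) :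
  is_derive_on I f x l ->
  forall eps : posreal, within I (locally x) (fun y =>
    Rabs (f y - f x - (y - x) * l) <= eps * Rabs (y - x)).
Proof.
intros [_ h] eps.
assert (hx : is_filter_lim (within I (locally x)) x)
  by (intros P; apply filter_le_within; apply locally_filter).
exact (h x hx eps).
Qed.

Lemma is_derive_on_continuous (I : R -> Prop) (f : R -> R) (x l : R) :
  is_derive_on I f x l -> filterlim f (within I (locally x)) (locally (f x)).
Proof.
intros h. apply filterlim_locally. intros eps.
(* With error constant 1, [f y - f x] is bounded by [(1 + Rabs l) * Rabs (y - x)] near [x], whence
   the radius below. *)
destruct (is_derive_on_bound _ _ _ _ h (mkposreal 1 Rlt_0_1)) as [d hd].
assert (hk : 0 < 1 + Rabs l) by (pose proof (Rabs_pos l); lra).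
assert (hd' : 0 < Rmin d (eps / (1 + Rabs l))).
{ apply Rmin_pos; [apply cond_pos |].
  apply Rdiv_lt_0_compat; [apply cond_pos | exact hk]. }
exists (mkposreal _ hd'). intros y hy hI.
assert (hy' : Rabs (y - x) < Rmin d (eps / (1 + Rabs l))) by exact hy.
pose proof (Rmin_l d (eps / (1 + Rabs l))).
pose proof (Rmin_r d (eps / (1 + Rabs l))).
assert (hyd : ball x d y) by (change (Rabs (y - x) < d); lra).
specialize (hd y hyd hI). simpl in hd.
change (Rabs (f y - f x) < eps).
assert (hlt : Rabs (y - x) * (1 + Rabs l) < eps).
{ apply (Rmult_lt_reg_r (/ (1 + Rabs l))); [apply Rinv_0_lt_compat, hk |].
  rewrite Rmult_assoc, Rinv_r, Rmult_1_r by lra.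
  change (Rabs (y - x) < eps / (1 + Rabs l)). lra. }
pose proof (Rabs_triang (f y - f x - (y - x) * l) ((y - x) * l)) as ht.
replace (f y - f x - (y - x) * l + (y - x) * l) with (f y - f x) in ht by ring.
rewrite (Rabs_mult (y - x) l) in ht. lra.
Qed.

(** A nondegenerate interval has no isolated point; this is what makes relative derivatives
    unique. *)
Lemma interval_near (I : R -> Prop) (x d : R) :
  interval I -> I x -> 0 < d -> exists y, I y /\ y <> x /\ Rabs (y - x) < d.
Proof.
intros [[a [b [ha [hb hab]]]] hI] hx hd.
assert (hz : exists z, I z /\ z <> x).
{ destruct (Req_dec a x) as [e | ne]; [exists b | exists a]; split; auto; lra. }
destruct hz as [z [hz hzx]].
destruct (Rlt_dec x z) as [hlt | hge].
- exists (x + Rmin (z - x) (d / 2)).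
  assert (0 < Rmin (z - x) (d / 2)) by (apply Rmin_pos; lra).
  pose proof (Rmin_l (z - x) (d / 2)). pose proof (Rmin_r (z - x) (d / 2)).
  repeat split; try lra.
  + apply (hI x z); auto; lra.
  + apply Rabs_def1; lra.
- exists (x - Rmin (x - z) (d / 2)).
  assert (0 < Rmin (x - z) (d / 2)) by (apply Rmin_pos; lra).
  pose proof (Rmin_l (x - z) (d / 2)). pose proof (Rmin_r (x - z) (d / 2)).
  repeat split; try lra.
  + apply (hI z x); auto; lra.
  + apply Rabs_def1; lra.
Qed.

Lemma is_derive_on_unique (I : R -> Prop) (f : R -> R) (x l1 l2 : R) :
  interval I -> I x -> is_derive_on I f x l1 -> is_derive_on I f x l2 ->
  l1 = l2.
Proof.
intros hI hx h1 h2.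
destruct (Req_dec l1 l2) as [e | ne]; [exact e | exfalso].
(* Two errors of at most a third of the gap each cannot add up to the gap. *)
assert (he : 0 < Rabs (l1 - l2) / 3)
  by (assert (0 < Rabs (l1 - l2)) by (apply Rabs_pos_lt; lra); lra).
set (eps := mkposreal _ he).
destruct (filter_and _ _ (is_derive_on_bound _ _ _ _ h1 eps)
            (is_derive_on_bound _ _ _ _ h2 eps)) as [d hd].
destruct (interval_near I x d hI hx (cond_pos d)) as [y [hy [hyx hyd]]].
destruct (hd y hyd hy) as [b1 b2]. simpl in b1, b2.
pose proof (Rabs_triang (f y - f x - (y - x) * l2)
              (- (f y - f x - (y - x) * l1))) as ht.
rewrite Rabs_Ropp in ht.
replace (f y - f x - (y - x) * l2 + - (f y - f x - (y - x) * l1))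
  with ((l1 - l2) * (y - x)) in ht by ring.
rewrite Rabs_mult in ht.
assert (0 < Rabs (y - x)) by (apply Rabs_pos_lt; lra).
nra.
Qed.

Lemma within_locally_proper (I : R -> Prop) (x : R) :
  I x -> ProperFilter' (within I (locally x)).
Proof.
intros hx. split; [| apply within_filter, locally_filter].
intros [d hd]. apply (hd x); [apply ball_center | exact hx].
Qed.

(** The chain rule for filters asks for [g] to be differentiable along the image under [f] of the
    relative neighbourhoods of [x]. Continuity of [f] makes that image filter converge to [f x], so
    the differential of [g] at [f x] passes to it. *)
Lemma is_derive_on_comp (I : R -> Prop) (f g : R -> R) (x l m : R) :
  I x -> is_derive_on I f x l -> is_derive g (f x) m ->
  is_derive_on I (fun y => g (f y)) x (l * m).
Proof.
intros hx hf [hg1 hg2].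
apply (filterdiff_ext_lin _ (fun h : R => scal (scal h l) m)).
- apply (filterdiff_comp (W := R_NormedModule) f g _ (fun h => scal h m));
    [exact hf |].
  split; [exact hg1 |]. intros z hz.
  assert (hc := is_derive_on_continuous _ _ _ _ hf).
  assert (e : z = f x).
  { apply (is_filter_lim_unique (V := R_NormedModule)
             (FF := filtermap_proper_filter' _ _ f _
                      (within_locally_proper I x hx)));
      [exact hz | exact hc]. }
  subst z.
  apply (is_domin_le (F := locally (f x))); [| exact hc].
  apply hg2. intros P hP. exact hP.
- intros h. unfold scal; simpl; unfold mult; simpl. ring.
Qed.

Lemma within_locally_lim (I : R -> Prop) (x z : R) :
  I x -> is_filter_lim (within I (locally x)) z -> z = x.
Proof.
intros hx hz.
apply (is_filter_lim_unique (V := R_NormedModule)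
         (FF := within_locally_proper I x hx)); [exact hz |].
intros P. apply filter_le_within.
Qed.

Lemma is_derive_on_ext (I : R -> Prop) (f g : R -> R) (x l : R) :
  I x -> within I (locally x) (fun y => f y = g y) ->
  is_derive_on I f x l -> is_derive_on I g x l.
Proof.
intros hx hfg. apply filterdiff_ext_loc; [exact hfg |].
intros z hz. rewrite (within_locally_lim I x z hx hz).
destruct hfg as [d hd]. apply hd; [apply ball_center | exact hx].
Qed.

Lemma is_derive_on_comb (I : R -> Prop) (f g : R -> R) (a b x l m : R) :
  is_derive_on I f x l -> is_derive_on I g x m ->
  is_derive_on I (fun y => a * f y + b * g y) x (a * l + b * m).
Proof.
intros hf hg.
apply (filterdiff_ext_lin (V := R_NormedModule) _
  (fun h : R => plus (scal a (scal h l)) (scal b (scal h m)))).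
- apply (filterdiff_plus_fct (V := R_NormedModule)
           (fun y => scal a (f y)) (fun y => scal b (g y)));
    apply (filterdiff_scal_r_fct (V := R_NormedModule));
    first [exact Rmult_comm | assumption].
- intros h. unfold scal, plus; simpl; unfold mult; simpl. ring.
Qed.

Lemma is_derive_on_plus_const (I : R -> Prop) (f : R -> R) (k x l : R) :
  I x -> is_derive_on I f x l -> is_derive_on I (fun y => f y + k) x l.
Proof.
intros hx hf. replace l with (l * 1) by ring.
apply (is_derive_on_comp I f (fun u => u + k)); [exact hx | exact hf |].
auto_derive; [exact Logic.I | ring].
Qed.

(** * Differentiability of the continuous angle *)

Lemma is_derive_asin_0 : is_derive asin 0 1.
Proof.
assert (h : -1 < 0 < 1) by lra.
apply is_derive_Reals.
pose proof (derive_pt_asin 0 h) as e.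
apply derive_pt_eq_1 in e.
replace (1 / sqrt (1 - 0²)) with 1 in e; [exact e |].
unfold Rsqr. rewrite Rmult_0_l, Rminus_0_r, sqrt_1. field.
Qed.

(* With (c, s) = (cos theta, sin theta), the difference theta y - theta x is the
   arcsine of c x * s y - s x * c y as soon as it is small. *)
Lemma is_derive_on_angle (I : R -> Prop) (theta c s : R -> R) (x tau : R) :
  continuous_on I theta ->
  (forall y, I y -> cos (theta y) = c y /\ sin (theta y) = s y) -> I x ->
  is_derive_on I c x (- tau * s x) -> is_derive_on I s x (tau * c x) ->
  is_derive_on I theta x tau.
Proof.
intros hth hcs hx hc hs.
set (w := fun y => c x * s y + - s x * c y).
assert (hw : is_derive_on I w x tau).
(* At [x] the derivative of [w] is [tau] times the squared norm of [(c x, s x)], which is 1. *)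
{ replace tau with (c x * (tau * c x) + - s x * (- tau * s x)).
  - apply is_derive_on_comb; assumption.
  - destruct (hcs x hx) as [e1 e2].
    pose proof (sin2_cos2 (theta x)) as e. unfold Rsqr in e.
    rewrite e1, e2 in e.
    transitivity (tau * (s x * s x + c x * c x)); [ring | rewrite e; ring]. }
assert (hw0 : w x = 0) by (unfold w; ring).
assert (ha : is_derive_on I (fun y => asin (w y)) x tau).
{ replace tau with (tau * 1) by ring.
  apply is_derive_on_comp; [exact hx | exact hw |].
  rewrite hw0. apply is_derive_asin_0. }
assert (hsin : forall y, I y -> w y = sin (theta y - theta x)).
{ intros y hy. destruct (hcs x hx) as [e1 e2]. destruct (hcs y hy) as [e3 e4].
  unfold w; rewrite sin_minus, e1, e2, e3, e4. ring. }
(* Since 1 < PI / 2, a difference below 1 lies where [asin] inverts [sin]; continuity of [theta]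
   ensures such a difference near [x]. *)
assert (heq : forall y, I y -> Rabs (theta y - theta x) < 1 ->
          asin (w y) + theta x = theta y).
{ intros y hy hlt. apply Rabs_def2 in hlt. pose proof PI2_1.
  rewrite (hsin y hy), asin_sin by lra. ring. }
apply (is_derive_on_ext I (fun y => asin (w y) + theta x)); [exact hx | |].
- destruct (proj1 (filterlim_locally theta (theta x)) (hth x hx)
              (mkposreal 1 Rlt_0_1)) as [d hd].
  exists d. intros y hy hIy.
  apply heq; [exact hIy | exact (hd y hy hIy)].
- apply is_derive_on_plus_const; assumption.
Qed.

(** * The Darboux frame in coordinates and the position vector *)

(** A zero first component puts [dotG] in its Euclidean branch, so the Galilean norm of [n] is the
    Euclidean norm in the plane of the last two coordinates. *)
Lemma unit_normal_components (M : G3 -> Prop) (p n : G3) :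
  unit_normal_at M p n ->
  x1 n = 0 /\ x2 n * x2 n + x3 n * x3 n = 1.
Proof.
intros [h1 [h2 _]]. split; [exact h1 |].
unfold normG, dotG in h2. rewrite h1 in h2.
destruct (Req_dec_T 0 0) as [_ | ne]; [| lra].
rewrite Rabs_pos_eq in h2 by nra.
rewrite <- (sqrt_sqrt (x2 n * x2 n + x3 n * x3 n)) by nra.
rewrite h2. ring.
Qed.

Lemma is_derive_on_id (I : R -> Prop) (x : R) :
  is_derive_on I (fun y => y) x 1.
Proof.
apply (filterdiff_ext_lin _ (fun h : R => h)).
- apply filterdiff_id.
- intros h. symmetry. apply Rmult_1_r.
Qed.

(* Every integral sign is an antiderivative on I with its own constant of
   integration: A2 and A3 are the antiderivatives of tau_g under the sine and
   the cosine.  They cannot in general be taken equal: with Q = n x T one gets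
   A3 = A2 + PI. *)
Theorem theorem4p7 (I : R -> Prop) (M : G3 -> Prop) (N : G3 -> G3)
    (beta T Q n : R -> G3) (kappa_g kappa_n tau_g : R -> R)
    (hI : interval I)
    (hM : oriented_surface M N)
    (hbeta : unit_speed_curve_on I M beta)
    (hframe : Darboux_frame I N beta T Q n kappa_g kappa_n tau_g)
    (hasym : asymptotic I kappa_n) :
  exists A2 A3 B2 B3 Y Z : R -> R,
    antiderivative_on I tau_g A2 /\
    antiderivative_on I tau_g A3 /\
    antiderivative_on I (fun x => kappa_g x * sin (A2 x)) B2 /\
    antiderivative_on I (fun x => kappa_g x * cos (A3 x)) B3 /\
    antiderivative_on I B2 Y /\
    antiderivative_on I B3 Z /\
    (forall x, I x -> beta x = (x, Y x, Z x)).
Proof.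
destruct hframe as [hT hn hQ hT' _ hn'].
assert (hunit : forall x, I x -> x1 (n x) = 0 /\
          x2 (n x) * x2 (n x) + x3 (n x) * x3 (n x) = 1).
{ intros x hx. rewrite (hn x hx).
  apply (unit_normal_components M (beta x)).
  exact (proj1 (proj2 hM (beta x) (proj1 (hbeta x hx)))). }
(* On [I] the first coordinate of [beta] is the identity, and relative derivatives are unique. *)
assert (hT1 : forall x, I x -> x1 (T x) = 1).
{ intros x hx.
  apply (is_derive_on_unique I (fun y => x1 (beta y)) x); auto.
  - apply is_derive_on_linear; [apply is_linear_x1 | exact (hT x hx)].
  - apply (is_derive_on_ext I (fun y => y)); [exact hx | |].
    + exists (mkposreal 1 Rlt_0_1). intros y _ hy. symmetry.
      exact (proj2 (hbeta y hy)).
    + apply is_derive_on_id. }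
assert (hQE : forall x, I x -> Q x = (0, x3 (n x), - x2 (n x))).
{ intros x hx. rewrite (hQ x hx). unfold crossG.
  rewrite (proj1 (hunit x hx)), (hT1 x hx).
  f_equal; [f_equal |]; ring. }
(* With [Q] in coordinates, the equation for the derivative of [n] says that [(x2 n, x3 n)] turns
   with angular speed [tau_g]. *)
assert (hn2 : forall x, I x ->
          is_derive_on I (fun y => x2 (n y)) x (- tau_g x * x3 (n x))).
{ intros x hx. pose proof (hn' x hx) as h. rewrite (hQE x hx) in h.
  exact (is_derive_on_linear _ I n x2 x _ is_linear_x2 h). }
assert (hn3 : forall x, I x ->
          is_derive_on I (fun y => x3 (n y)) x (tau_g x * x2 (n x))).
{ intros x hx. pose proof (hn' x hx) as h. rewrite (hQE x hx) in h.
  replace (tau_g x * x2 (n x)) with (- tau_g x * - x2 (n x)) by ring.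
  exact (is_derive_on_linear _ I n x3 x _ is_linear_x3 h). }
destruct (angle_lift_interval I (fun x => x2 (n x)) (fun x => x3 (n x)))
  as [theta [ctheta htheta]].
{ exact hI. }
{ intros x hx. exact (is_derive_on_continuous _ _ _ _ (hn2 x hx)). }
{ intros x hx. exact (is_derive_on_continuous _ _ _ _ (hn3 x hx)). }
{ intros x hx. exact (proj2 (hunit x hx)). }
assert (dtheta : antiderivative_on I tau_g theta).
{ intros x hx.
  exact (is_derive_on_angle I theta _ _ x _ ctheta htheta hx
           (hn2 x hx) (hn3 x hx)). }
(* The last component of [Q] is [- cos (theta x)]; the shift by PI absorbs the sign. *)
assert (hT'E : forall x, I x -> is_derive_on I T x
          (0, kappa_g x * sin (theta x), kappa_g x * cos (theta x + PI))).
{ intros x hx. pose proof (hT' x hx) as h.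
  rewrite (hasym x hx), (hQE x hx) in h.
  destruct (htheta x hx) as [e1 e2].
  rewrite neg_cos, e1, e2.
  match type of h with is_derive_on _ _ _ ?v => replace v with
    (0, kappa_g x * x3 (n x), kappa_g x * - x2 (n x)) in h; [exact h |] end.
  destruct (n x) as [[a b] c].
  change ((0, kappa_g x * c, kappa_g x * - b) =
    (kappa_g x * 0 + 0 * a, kappa_g x * c + 0 * b, kappa_g x * - b + 0 * c)).
  f_equal; [f_equal |]; ring. }
(* Taking the components of [T] and [beta] themselves as the successive antiderivatives fixes all
   constants of integration. *)
exists theta, (fun x => theta x + PI), (fun x => x2 (T x)), (fun x => x3 (T x)),
  (fun x => x2 (beta x)), (fun x => x3 (beta x)).
refine (conj _ (conj _ (conj _ (conj _ (conj _ (conj _ _)))))).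
- exact dtheta.
- intros x hx. apply is_derive_on_plus_const; [exact hx | exact (dtheta x hx)].
- intros x hx. exact (is_derive_on_linear _ I T x2 x _ is_linear_x2 (hT'E x hx)).
- intros x hx. exact (is_derive_on_linear _ I T x3 x _ is_linear_x3 (hT'E x hx)).
- intros x hx. exact (is_derive_on_linear _ I beta x2 x _ is_linear_x2 (hT x hx)).
- intros x hx. exact (is_derive_on_linear _ I beta x3 x _ is_linear_x3 (hT x hx)).
- intros x hx. pose proof (proj2 (hbeta x hx)) as e.
  destruct (beta x) as [[a b] c]. now rewrite <- e.
Qed.
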